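(* Let $F$ be a tree on $\ell\geq 4$ vertices, let $A,B$ be the two partite sets of $F$ with $|A|\leq|B|$, and let $q=|A|-1$. If $q\geq 1$, then there is $n_0$ such that for every $n\geq n_0$, every graph in ${\rm SPEX}(n,F)$ contains a spanning subgraph isomorphic to the complete bipartite graph $K_{q,n-q}$.
   Context: For a graph $G$, $\rho(G)$ denotes the spectral radius (largest eigenvalue) of its adjacency matrix. A graph is $F$-free if it contains no subgraph isomorphic to $F$. ${\rm spex}(n,F)$ is the maximum of $\rho(G)$ over all $F$-free graphs $G$ on $n$ vertices, and ${\rm SPEX}(n,F)$ is the set of $F$-free graphs on $n$ vertices with spectral radius equal to ${\rm spex}(n,F)$. *)

(* Defs.v *)
From HB Require Import structures.
From mathcomp Require Import all_boot all_order all_algebra.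
From mathcomp Require Import all_classical all_reals.

Set Implicit Arguments.
Unset Strict Implicit.
Unset Printing Implicit Defensive.

Import Order.TTheory GRing.Theory Num.Theory.

Local Open Scope classical_set_scope.
Local Open Scope ring_scope.

Record sgraph := SGraph {
  vert :> finType;
  adj : rel vert;
  adj_sym : symmetric adj;
  adj_irr : irreflexive adj }.

Definition isomorphic (G H : sgraph) : Prop :=
  exists f : G -> H, bijective f /\ forall x y, adj (f x) (f y) = adj x y.

(** Subgraphs need be neither induced nor spanning. *)
Record subgraph (G : sgraph) := Subgraph {
  sub_verts : {set G};
  sub_adj : rel G;
  sub_adj_sym : symmetric sub_adj;
  sub_adjP : forall x y, sub_adj x y ->
    [/\ x \in sub_verts, y \in sub_verts & adj x y] }.

Section SubgraphAsGraph.
Variables (G : sgraph) (S : subgraph G).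

Let T := {x : G | x \in sub_verts S}.
Let e : rel T := fun x y => sub_adj S (val x) (val y).

Fact subgraph_sym : symmetric e.
Proof. by move=> x y; apply: sub_adj_sym. Qed.

Fact subgraph_irr : irreflexive e.
Proof.
by move=> x; apply/negP => /sub_adjP [_ _]; rewrite adj_irr.
Qed.

Definition graph_of_subgraph : sgraph := SGraph subgraph_sym subgraph_irr.
End SubgraphAsGraph.

Coercion graph_of_subgraph : subgraph >-> sgraph.

Definition spanning (G : sgraph) (S : subgraph G) : Prop :=
  sub_verts S = [set: G]%SET.

Definition F_free (F G : sgraph) : Prop :=
  ~ exists S : subgraph G, isomorphic S F.

Section CompleteBipartite.
Variables a b : nat.

Let e : rel ('I_a + 'I_b)%type := fun x y =>
  match x, y with
  | inl _, inr _ | inr _, inl _ => true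
  | _, _ => false
  end.

Fact complete_bipartite_sym : symmetric e.
Proof. by move=> [x|x] [y|y]. Qed.

Fact complete_bipartite_irr : irreflexive e.
Proof. by case. Qed.

Definition complete_bipartite : sgraph :=
  SGraph complete_bipartite_sym complete_bipartite_irr.
End CompleteBipartite.

(** A cycle is given by its duplicate-free list of vertices; the size bound
    is needed because [ucycle] also holds of [[:: x; y]] for an edge xy. *)
Definition acyclic (G : sgraph) : Prop :=
  forall c : seq G, (3 <= size c)%N -> ~ ucycle (@adj G) c.

Definition is_tree (G : sgraph) : Prop :=
  [/\ (0 < #|G|)%N, forall x y : G, connect (@adj G) x y & acyclic G].

Definition partite_sets (G : sgraph) (A B : {set G}) : Prop :=
  [/\ (A :|: B = [set: G])%SET, (A :&: B = finset.set0)%SET &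
      forall x y : G, adj x y ->
        (x \in A) && (y \in B) || (x \in B) && (y \in A)].

Section Spectral.
Variable R : realType.

Definition adjmx (G : sgraph) : 'M[R]_#|G| :=
  \matrix_(i, j) (adj (enum_val i) (enum_val j))%:R.

(** The matrix is real symmetric, so all its eigenvalues lie in [R]; there
    are finitely many, so [sup] is the largest one. *)
Definition spectral_radius (G : sgraph) : R :=
  sup [set a : R | eigenvalue (adjmx G) a].

(** There are finitely many graphs on n vertices up to isomorphism, so this
    [sup] is a maximum as soon as an F-free graph on n vertices exists. *)
Definition spex (n : nat) (F : sgraph) : R :=
  sup [set r : R | exists G : sgraph,
         [/\ #|G| = n, F_free F G & r = spectral_radius G]].

Definition SPEX (n : nat) (F G : sgraph) : Prop :=
  [/\ #|G| = n, F_free F G & spectral_radius G = spex n F].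
End Spectral.

(* Main.v *)
Require Import Defs.
From mathcomp Require Import all_boot all_order all_algebra.
From mathcomp Require Import all_classical all_reals.
From mathcomp Require Import topology normedtype derive.
From mathcomp Require Import fintype finset zify lra ring.

(** Let [k = |F|], [n = |G|], and let [x] be a Perron vector of the extremal
    graph [G] with largest entry 1.  Since K_{q,n-q} is F-free,
    [rho^2 >= q(n-q)].  Greedy tree embedding shows that an F-free graph has at
    most [k|T|] edges inside a vertex set [T], at most [q|Y| + k|X|] edges
    between disjoint sets [X] and [Y], and that [q+1] vertices have fewer than
    [k] common neighbours.

    Only [o(n)] vertices have [x_v >= eta].  Counting the walks of length two
    from [v] in [rho^2 x_v = sum_{u ~ v} sum_{w ~ u} x_w], those ending outside
    this set contribute [O(eta n)] and the others at most [q d(v) + o(n)], hence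
    [d(v) >= (x_v - eps) n].  Consequently at most [q] vertices have [x_v] close
    to 1, and, repeating the count from a vertex with [x_z = 1], at least [q]
    do.  Let [top] be this set of [q] vertices and [W] its common neighbourhood,
    which contains almost all vertices.  A vertex outside [top] has fewer than
    [k] neighbours in [W], so its degree, and therefore its entry of [x], is
    small.

    If some vertex lies in neither [top] nor [W], then an averaging argument
    gives such a vertex [v] with at most [3k] neighbours outside [top].
    Replacing the neighbourhood of [v] by [top] keeps the graph F-free and
    increases the Rayleigh quotient of [x], a contradiction. *)

Set Implicit Arguments.
Unset Strict Implicit.
Unset Printing Implicit Defensive.

Import Order.TTheory GRing.Theory Num.Theory.
Import numFieldNormedType.Exports.

(** * Embedding trees in F-free graphs *)

Definition embedding (F G : sgraph) (f : F -> G) : Prop :=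
  injective f /\ forall a b, adj a b -> adj (f a) (f b).

(** The image vertices with the image edges form a subgraph isomorphic to [F]. Other edges of [G]
    among these vertices are dropped, since [f] need not reflect adjacency. *)
Lemma F_free_embedding (F G : sgraph) (f : F -> G) :
  F_free F G -> ~ embedding f.
Proof.
move=> FG [f_inj f_hom]; apply: FG.
pose e (x y : G) := [exists a, exists b, [&& adj a b, f a == x & f b == y]].
have eP x y : reflect (exists a b, [/\ adj a b, f a = x & f b = y]) (e x y).
  apply: (iffP existsP) => [[a /existsP[b /and3P[ab /eqP<- /eqP<-]]]|].
    by exists a, b.
  by case=> a [b [ab <- <-]]; exists a; apply/existsP; exists b; rewrite ab !eqxx.
have e_sym : symmetric e.
  by move=> x y; apply/eP/eP => -[a [b [ab <- <-]]]; exists b, a; rewrite adj_sym.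
have e_sub x y : e x y ->
    [/\ x \in [set f a | a : F], y \in [set f a | a : F] & adj x y].
  by case/eP=> a [b [ab <- <-]]; rewrite !imset_f // f_hom.
exists (Subgraph e_sym e_sub).
have g_ex (x : {x | x \in [set f a | a : F]}) : {a | f a = val x}.
  by apply: cid; case: x => x /= /imsetP[a _ ->]; exists a.
have fE a : f a \in [set f a | a : F] by apply: imset_f.
exists (fun x => sval (g_ex x)); split.
  exists (fun a => exist _ (f a) (fE a)) => [x|a].
    by apply: val_inj => /=; case: (g_ex x).
  by apply: f_inj; case: (g_ex _).
move=> x y; case: (g_ex x) => a /= fa; case: (g_ex y) => b /= fb.
change (adj a b = e (val x) (val y)).
apply/idP/eP => [ab|[a' [b' [ab fa' fb']]]]; first by exists a, b.
have <- : a' = a by apply: f_inj; apply: etrans fa' (esym fa).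
by have <- : b' = b by apply: f_inj; apply: etrans fb' (esym fb).
Qed.

Lemma embedding_F_free (F G : sgraph) :
  (forall f : F -> G, ~ embedding f) -> F_free F G.
Proof.
move=> noemb [S [g [[h gK hK] g_adj]]]; apply: (noemb (fun a => val (h a))).
split=> [a b /val_inj /(can_inj hK) //|a b ab].
have: sub_adj S (val (h a)) (val (h b)).
  by move: (g_adj (h a) (h b)); rewrite !hK ab => /esym.
by case/sub_adjP.
Qed.

Definition deg_in (G : sgraph) (S : {set G}) (v : G) : nat :=
  #|[set w in S | adj v w]|.

(** * Greedy embedding of a tree *)

Section TreeEmbedding.
Variables (F G : sgraph).
Hypothesis F_tree : is_tree F.

Let adj_on (D : {set F}) := [rel u v : F | [&& adj u v, u \in D & v \in D]].

(** Without such an edge [D] would be closed under adjacency, hence all of the connected graph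
    [F]. *)
Lemma exists_boundary_edge (D : {set F}) (r : F) :
  r \in D -> D != [set: F]%SET ->
  exists a b, [/\ a \in D, b \notin D & adj a b].
Proof.
case: F_tree => _ F_conn _ rD; rewrite -subTset => /subsetPn[v _ vD].
apply: contrapT => noedge.
have cl : fingraph.closed (@adj F) (mem D).
  move=> x y xy; apply/idP/idP => [xD|yD]; apply: contrapT => /negP nD.
    by apply: noedge; exists x, y.
  by apply: noedge; exists y, x; rewrite adj_sym.
by move: vD; rewrite -(closed_connect cl (F_conn r v)) rD.
Qed.

Lemma unique_boundary_neighbour (D : {set F}) (a a' b : F) :
  {in D &, forall x y, connect (adj_on D) x y} ->
  a \in D -> a' \in D -> b \notin D -> adj a b -> adj a' b -> a = a'.
Proof.
move=> D_conn aD a'D bD ab a'b; apply/eqP/negP => /negP neq.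
case: F_tree => _ _ F_acyclic.
have /connectP[p p_path p_last] := D_conn _ _ aD a'D.
case/shortenP: p_path p_last => p' p'_path p'_uniq _ p'_last.
have p'D : {subset p' <= D}.
  elim: p' a p'_path {aD ab neq p'_uniq p'_last} => //= c s IHs a.
  case/andP=> /and3P[_ _ cD] /IHs sub x.
  by rewrite inE => /predU1P[->|/sub].
(* A duplicate-free path inside [D] from [a] to [a'] closes up through [b]; [a != a'] makes [p']
   nonempty, so the cycle has length at least 3. *)
apply: (F_acyclic (b :: a :: p')).
  by case: p' p'_last {p'D p'_path p'_uniq} => //= a'a; rewrite a'a eqxx in neq.
rewrite /ucycle [cycle _ _]/= rcons_path -p'_last a'b andbT adj_sym ab /=.
apply/andP; split.
  by apply: sub_path p'_path => x y /and3P[].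
apply/andP; split=> //; rewrite inE negb_or.
apply/andP; split; first by apply: contraNneq bD => ->.
by apply: contra bD; apply: p'D.
Qed.

Lemma connect_on_extend (D : {set F}) (a b : F) :
  {in D &, forall x y, connect (adj_on D) x y} -> a \in D -> adj a b ->
  {in b |: D &, forall x y, connect (adj_on (b |: D)) x y}.
Proof.
move=> D_conn aD ab.
have mono x y : connect (adj_on D) x y -> connect (adj_on (b |: D)) x y.
  apply: connect_sub => u v /and3P[uv uD vD]; apply: connect1.
  by rewrite /= uv !inE uD vD !orbT.
have ab' : connect (adj_on (b |: D)) a b.
  by apply: connect1; rewrite /= ab !inE eqxx aD orbT.
have ba' : connect (adj_on (b |: D)) b a.
  by apply: connect1; rewrite /= adj_sym ab !inE eqxx aD orbT.
move=> x y; rewrite !inE => /predU1P[->|xD] /predU1P[->|yD] //.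
- exact: connect_trans ba' (mono _ _ (D_conn _ _ aD yD)).
- exact: connect_trans (mono _ _ (D_conn _ _ xD aD)) ab'.
- exact: mono (D_conn _ _ xD yD).
Qed.

(* Greedy embedding along a growing subtree: the next vertex [b] has a single
   neighbour already placed, and only vertices [c] whose candidate set meets
   that of [b] can block a candidate for [b]. *)
Lemma tree_embedding (P : F -> {set G}) (r : F) :
  P r != finset.set0 ->
  (forall a b y, adj a b -> y \in P a ->
     #|[set c | (c != b) && ~~ [disjoint P c & P b]]| < deg_in (P b) y)%N ->
  exists f : F -> G, embedding f.
Proof.
case/set0Pn => y0 y0P room.
suff grow m : (0 < m <= #|F|)%N -> exists (D : {set F}) (f : F -> G),
  [/\ #|D| = m, r \in D, {in D &, forall x y, connect (adj_on D) x y},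
      {in D &, injective f} & {in D, forall x, f x \in P x} /\
      {in D &, forall x y, adj x y -> adj (f x) (f y)}].
  have [|D [f [Dcard _ _ f_inj [_ f_hom]]]] := grow #|F|.
    by rewrite leqnn andbT; apply/card_gt0P; exists r.
  have DT : D = [set: F]%SET.
    by apply/eqP; rewrite eqEcard finset.subsetT cardsT Dcard leqnn.
  by exists f; split=> [x y|x y]; [apply: f_inj|apply: f_hom]; rewrite DT inE.
elim: m => // -[_ _|m IHm /andP[_ mF]].
  exists [set r]%SET, (fun=> y0); split; rewrite ?cards1 ?set11 //.
  - by move=> x y /set1P-> /set1P->; apply: connect0.
  - by move=> x y /set1P-> /set1P->.
  - split=> [x /set1P->|x y /set1P-> /set1P->] //; by rewrite adj_irr.
have [|D [f [Dcard rD D_conn f_inj [f_P f_hom]]]] := IHm; first by rewrite /= ltnW.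
have [|a [b [aD bD ab]]] := @exists_boundary_edge D r rD.
  by apply: contraTneq mF => DT; rewrite -leqNgt -Dcard DT cardsT.
have [w wP [wf aw]] : exists2 w, w \in P b &
    w \notin [set f x | x in D] /\ adj (f a) w.
  apply: contrapT => none.
  have := room _ _ _ ab (f_P _ aD); rewrite ltnNge => /negP; apply.
  pose C := [set c | (c != b) && ~~ [disjoint P c & P b]].
  (* If every candidate neighbour is used, all of them are images of vertices in [C], which is too
     small by [room]. *)
  apply: leq_trans (leq_imset_card f C); apply/subset_leq_card/subsetP => w.
  rewrite inE => /andP[wP aw].
  have /imsetP[c cD wE] : w \in [set f x | x in D].
    by apply: contrapT => /negP wf; apply: none; exists w.
  rewrite wE imset_f // inE; apply/andP; split.
    by apply: contraTneq cD => ->.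
  apply/pred0Pn; exists w; rewrite /= wP andbT wE; exact: f_P.
pose g x := if x == b then w else f x.
have gD x : x \in D -> g x = f x.
  by rewrite /g; case: eqP => // -> bD'; rewrite bD' in bD.
have gb : g b = w by rewrite /g eqxx.
exists (b |: D), g; split.
- by rewrite cardsU1 bD Dcard.
- by rewrite !inE rD orbT.
- exact: connect_on_extend ab.
- move=> x y; rewrite !inE => /predU1P[->|xD] /predU1P[->|yD] //.
  + by rewrite gb gD // => wE; rewrite wE imset_f in wf.
  + by rewrite gb gD // => wE; rewrite -wE imset_f in wf.
  + by rewrite !gD //; apply: f_inj.
split=> [x|x y].
  by rewrite !inE => /predU1P[->|xD]; rewrite ?gb ?gD //; apply: f_P.
rewrite !inE => /predU1P[->|xD] /predU1P[->|yD]; rewrite ?adj_irr //.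
- rewrite adj_sym => yb; have <- := unique_boundary_neighbour D_conn aD yD bD ab yb.
  by rewrite gb gD // adj_sym.
- by move=> xb; have <- := unique_boundary_neighbour D_conn aD xD bD ab xb; rewrite gb gD.
- by rewrite !gD //; apply: f_hom.
Qed.

End TreeEmbedding.

(** * Degrees into a set and common neighbours *)

Lemma deg_inE (G : sgraph) (S : {set G}) (v : G) :
  deg_in S v = (\sum_(w in S) adj v w)%N.
Proof.
rewrite /deg_in -sum1_card.
rewrite (eq_bigl (fun w => (w \in S) && adj v w)) => [|w]; last by rewrite !inE.
by rewrite big_mkcondr; apply: eq_bigr => w _; case: adj.
Qed.

Lemma sum_deg_in_exchange (G : sgraph) (X Y : {set G}) :
  (\sum_(y in Y) deg_in X y = \sum_(x in X) deg_in Y x)%N.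
Proof.
under eq_bigr do rewrite deg_inE.
rewrite exchange_big /=; apply: eq_bigr => x _; rewrite deg_inE.
by apply: eq_bigr => y _; rewrite adj_sym.
Qed.

Definition common_nbrs (G : sgraph) (S : {set G}) : {set G} :=
  [set w | [forall s in S, adj s w]].

Lemma common_nbrsP (G : sgraph) (S : {set G}) (w : G) :
  reflect {in S, forall s, adj s w} (w \in common_nbrs S).
Proof. by rewrite inE; apply: (iffP forall_inP). Qed.

(** * Replacing the neighbourhood of a vertex *)

Section Rewire.
Variables (G : sgraph) (L : {set G}) (v : G).
Hypothesis vL : v \notin L.

Let e : rel G := fun x y =>
  if x == v then y \in L else if y == v then x \in L else adj x y.

Fact rewire_sym : symmetric e.
Proof.
move=> x y; rewrite /e adj_sym.
by case: (x =P v) => [xv|_]; case: (y =P v) => [yv|_] //; rewrite xv yv.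
Qed.

Fact rewire_irr : irreflexive e.
Proof. by move=> x; rewrite /e; case: eqP => [->|_]; rewrite ?(negPf vL) ?adj_irr. Qed.

Definition rewire : sgraph := SGraph rewire_sym rewire_irr.

Lemma rewireE (x y : rewire) : adj x y =
  if x == v then y \in L else if y == v then x \in L else @adj G x y.
Proof. by []. Qed.

End Rewire.

(** * Edge bounds for graphs without a given tree *)

Section TreeFree.
Variables (F : sgraph) (A B : {set F}).
Hypotheses (F_tree : is_tree F) (AB_parts : partite_sets A B).

Lemma adj_partite (a b : F) : adj a b -> (b \in A) = (a \notin A).
Proof.
case: AB_parts => _ AB0 AB_adj /AB_adj.
have notB x : x \in A -> x \in B -> False.
  by move=> xA xB; have := in_set0 x; rewrite -AB0 inE xA xB.
case/orP=> /andP[xA yB]; first by rewrite xA; apply/negP => /notB; apply.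
by rewrite yB; apply/esym/negP => /notB; apply.
Qed.

(** A connected graph has only one bipartition, so an embedding would put all of [A] or all of [B]
    on the side with [p] vertices. *)
Lemma complete_bipartite_F_free (p m : nat) :
  (p < #|A|)%N -> (#|A| <= #|B|)%N -> F_free F (complete_bipartite p m).
Proof.
move=> pA leAB; apply: embedding_F_free => f [f_inj f_hom].
case: F_tree => _ F_conn _; case: AB_parts => ABT AB0 _.
pose c x := if f x is inl _ then true else false.
have c_flip x y : adj x y -> c y = ~~ c x.
  by move=> /f_hom; rewrite /c; case: (f x) (f y) => [?|?] [?|?].
(* The vertices where the colouring pulled back along [f] and membership in [A] disagree; both flip
   along edges, so [Cl] is empty or everything. *)
pose Cl := [set x | c x (+) (x \in A)].
have Cl_closed : fingraph.closed (@adj F) (mem Cl).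
  move=> x y xy; rewrite !inE (c_flip _ _ xy) (adj_partite xy).
  by case: (c x); case: (x \in A).
have [r rA] : exists r, r \in A by apply/card_gt0P; case: #|A| pA.
have Clr x : (x \in Cl) = (r \in Cl) by rewrite (closed_connect Cl_closed (F_conn r x)).
have small (S : {set F}) : {in S, forall x, c x} -> (#|S| <= p)%N.
  move=> Sc; rewrite -(card_imset _ f_inj) -[X in (_ <= X)%N]card_ord.
  have inl_card := leq_imset_card (@inl 'I_p 'I_m) 'I_p.
  apply: leq_trans (leq_trans inl_card (leqnn _)).
  apply/subset_leq_card/subsetP => _ /imsetP[x /Sc + ->].
  by rewrite /c; case: (f x) => // i _; apply: imset_f.
case rCl: (r \in Cl).
  suff: (#|B| <= p)%N by lia.
  apply: small => x xB; have := Clr x; rewrite rCl inE.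
  by have := in_set0 x; rewrite -AB0 inE xB andbT => ->; rewrite addbF.
suff: (#|A| <= p)%N by lia.
by apply: small => x xA; have := Clr x; rewrite rCl inE xA; case: (c x).
Qed.

(** With candidate sets [X] for [A] and [Y] for [B], only vertices of the same part can block each
    other. So [|A|] neighbours suffice for placing a vertex of [A]; for [B] the crude bound [|F|] is
    enough. *)
Lemma bipartite_embedding (G : sgraph) (X Y : {set G}) :
  (0 < #|A|)%N -> [disjoint X & Y] -> X != finset.set0 ->
  {in X, forall x, #|F| <= deg_in Y x}%N ->
  {in Y, forall y, #|A| <= deg_in X y}%N ->
  exists f : F -> G, embedding f.
Proof.
case/card_gt0P => r rA XY X0 Xdeg Ydeg.
pose P c := if c \in A then X else Y.
apply: (@tree_embedding F G F_tree P r) => [|a b y ab]; first by rewrite /P rA.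
rewrite {1}/P; case: ifP => aA yP.
  have bA : (b \in A) = false by rewrite (adj_partite ab) aA.
  rewrite /P bA; apply: leq_trans (Xdeg _ yP).
  rewrite -[X in (_ < X)%N]cardsT (cardsD1 b [set: F]%SET) inE add1n ltnS.
  by apply/subset_leq_card/subsetP => c; rewrite !inE => /andP[->].
have bA : b \in A by rewrite (adj_partite ab) aA.
rewrite {2 3}/P bA; apply: leq_trans (Ydeg _ yP).
rewrite (cardsD1 b A) bA add1n ltnS.
apply/subset_leq_card/subsetP => c; rewrite !inE => /andP[->] /=.
by apply: contraR => /negPf cA; rewrite /P cA disjoint_sym.
Qed.

Section Host.
Variable G : sgraph.
Hypothesis G_free : F_free F G.

(** Deleting a vertex of degree below [|F|] lowers the degree sum by less than [2|F|]. If there is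
    none and [T] is nonempty, [F] embeds greedily into [T]. *)
Lemma sum_deg_in (T : {set G}) :
  (\sum_(u in T) deg_in T u <= 2 * #|F| * #|T|)%N.
Proof.
have [m] := ubnP #|T|; elim: m T => // m IHm T size_lt.
have [/exists_inP[u uT udeg]|/exists_inPn Tdeg] :=
  boolP [exists u in T, deg_in T u < #|F|]%N.
  rewrite (big_setD1 u) //=.
  under eq_bigr do rewrite deg_inE (big_setD1 u) //= -deg_inE.
  rewrite big_split /=.
  have := cardsD1 u T; rewrite uT => Tcard.
  have loss : (\sum_(v in T :\ u) adj v u <= deg_in T u)%N.
    rewrite deg_inE [X in (_ <= X)%N](big_setD1 u) //= adj_irr add0n; apply: eq_leq.
    by apply: eq_bigr => v _; rewrite adj_sym.
  have IH := IHm (T :\ u).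
  have {IH}/IH : (#|T :\ u| < m)%N by lia.
  rewrite Tcard mulnDr muln1 => IH; rewrite addnA leq_add // mul2n -addnn.
  by rewrite leq_add ?(ltnW udeg) // (leq_trans loss) // ltnW.
have [->|/set0Pn[u uT]] := eqVneq T finset.set0; first by rewrite big_set0.
case: F_tree => /card_gt0P[r _] _ _.
have [||f] := @tree_embedding F G F_tree (fun=> T) r.
- by apply/set0Pn; exists u.
- move=> a b y _ yT; apply: (@leq_trans #|F|); last by rewrite leqNgt Tdeg.
  rewrite -[X in (_ < X)%N]cardsT (cardsD1 b [set: F]%SET) inE add1n ltnS.
  by apply/subset_leq_card/subsetP => c; rewrite !inE => /andP[->].
by move/(F_free_embedding G_free).
Qed.

(* A copy of [F] using [v] can be moved to an unused common neighbour of [L]. *)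
Lemma rewire_F_free (L : {set G}) (v : G) (vL : v \notin L) :
  (#|F| < #|common_nbrs L|)%N -> F_free F (rewire vL).
Proof.
move=> W_large; apply: embedding_F_free => f [f_inj f_hom].
have [w wW wf] : exists2 w, w \in common_nbrs L & w \notin [set f x | x : F].
  apply: contrapT => none; move: W_large; rewrite ltnNge => /negP; apply.
  apply: leq_trans (leq_imset_card f F); apply/subset_leq_card/subsetP => w wW.
  by apply: contrapT => /negP wf; apply: none; exists w.
have wfE x : f x != w by apply: contraNneq wf => <-; apply: imset_f.
move/common_nbrsP: wW => wW.
apply: (@F_free_embedding F G (fun x => if f x == v then w else f x) G_free).
split=> [x y|x y /f_hom].
  case: eqP => [fx|_]; case: eqP => [fy|_]; last exact: f_inj.
  - by move=> _; apply: f_inj; rewrite fx fy.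
  - by move=> /esym/eqP; rewrite (negPf (wfE _)).
  - by move=> /eqP; rewrite (negPf (wfE _)).
rewrite rewireE; case: eqP => [fx yL|_]; case: eqP => [fy|_] //.
- by rewrite fy (negPf vL) in yL.
- by rewrite adj_sym wW.
- exact: wW.
Qed.

Hypothesis A_gt0 : (0 < #|A|)%N.

(** Otherwise [S] and its common neighbourhood, being completely joined, satisfy the degree
    conditions of [bipartite_embedding]. *)
Lemma card_common_nbrs_lt (S : {set G}) :
  #|S| = #|A| -> (#|common_nbrs S| < #|F|)%N.
Proof.
move=> SA; rewrite ltnNge; apply/negP => large.
have deg_Y x : x \in S -> deg_in (common_nbrs S) x = #|common_nbrs S|.
  move=> xS; apply: eq_card => w; rewrite inE.
  by case: (w \in _) / common_nbrsP => [/(_ x xS)|].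
have deg_S y : y \in common_nbrs S -> deg_in S y = #|S|.
  move=> /common_nbrsP yS; apply: eq_card => w; rewrite inE.
  by case wS: (w \in S) => //=; rewrite adj_sym yS.
have [|||x xS|y yS|f] := @bipartite_embedding G S (common_nbrs S).
- by [].
- apply/pred0P => x /=; apply/andP => -[xS /common_nbrsP/(_ x xS)].
  by rewrite adj_irr.
- by rewrite -card_gt0 SA.
- by rewrite deg_Y.
- by rewrite deg_S // SA.
exact: F_free_embedding G_free.
Qed.

(** Delete vertices of [Y] with fewer than [|A|] neighbours in [X], or vertices of [X] with fewer
    than [|F|] in [Y]. When neither exists and [X] is nonempty, [F] embeds. *)
Lemma sum_deg_in_bipartite (X Y : {set G}) : [disjoint X & Y] ->
  (\sum_(y in Y) deg_in X y <= (#|A| - 1) * #|Y| + #|F| * #|X|)%N.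
Proof.
have [m] := ubnP (#|X| + #|Y|)%N; elim: m X Y => // m IHm X Y size_lt XY.
have [/exists_inP[y yY ydeg]|/exists_inPn Ydeg] :=
  boolP [exists y in Y, deg_in X y < #|A|]%N.
  rewrite (big_setD1 y) //=.
  have := cardsD1 y Y; rewrite yY => Ycard.
  have /IHm IH : [disjoint X & Y :\ y] by apply: disjointWr XY; apply: subsetDl.
  have {IH}/IH : (#|X| + #|Y :\ y| < m)%N by lia.
  by rewrite Ycard mulnDr muln1 => IH; rewrite -addnA leq_add //; lia.
have [/exists_inP[x xX xdeg]|/exists_inPn Xdeg] :=
  boolP [exists x in X, deg_in Y x < #|F|]%N.
  rewrite sum_deg_in_exchange (big_setD1 x) //= -sum_deg_in_exchange.
  have := cardsD1 x X; rewrite xX => Xcard.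
  have /IHm IH : [disjoint X :\ x & Y] by apply: disjointWl XY; apply: subsetDl.
  have {IH}/IH : (#|X :\ x| + #|Y| < m)%N by lia.
  by rewrite Xcard mulnDr muln1 => IH; rewrite addnCA leq_add // ltnW.
have [->|X0] := eqVneq X finset.set0.
  by rewrite big1 // => y _; rewrite deg_inE big_set0.
have [x xX|y yY|f] := @bipartite_embedding G X Y A_gt0 XY X0.
- by rewrite leqNgt Xdeg.
- by rewrite leqNgt Ydeg.
by move/(F_free_embedding G_free).
Qed.

End Host.
End TreeFree.

(** * Rayleigh quotients and the spectral radius *)

Section Rayleigh.
Local Open Scope ring_scope.
Variables (R : realType) (G : sgraph).
Implicit Types x y : G -> R.

Definition nbr_sum x (v : G) : R := \sum_(w | adj v w) x w.
Definition qform x : R := \sum_v x v * nbr_sum x v.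
Definition sqnorm x : R := \sum_v x v ^+ 2.

Lemma nbr_sum_sym x y : \sum_v x v * nbr_sum y v = \sum_v y v * nbr_sum x v.
Proof.
transitivity (\sum_v \sum_(w | adj v w) x v * y w).
  by apply: eq_bigr => v _; rewrite mulr_sumr.
rewrite (exchange_big_dep xpredT) //=; apply: eq_bigr => w _.
by rewrite mulr_sumr; apply: eq_big => [v|v _]; rewrite ?(adj_sym v) // mulrC.
Qed.

Lemma qform_add x y (t : R) : qform (fun v => x v + t * y v) =
  qform x + 2 * t * (\sum_v y v * nbr_sum x v) + t ^+ 2 * qform y.
Proof.
have nbrD v : nbr_sum (fun v => x v + t * y v) v = nbr_sum x v + t * nbr_sum y v.
  by rewrite /nbr_sum big_split mulr_sumr.
have sym := nbr_sum_sym x y.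
rewrite /qform (eq_bigr (fun v => x v * nbr_sum x v + t * (y v * nbr_sum x v)
    + t * (x v * nbr_sum y v) + t ^+ 2 * (y v * nbr_sum y v))) => [|v _];
  last by rewrite nbrD; ring.
by rewrite !big_split -!mulr_sumr /= sym; ring.
Qed.

Lemma sqnorm_add x y (t : R) : sqnorm (fun v => x v + t * y v) =
  sqnorm x + 2 * t * (\sum_v y v * x v) + t ^+ 2 * sqnorm y.
Proof.
rewrite /sqnorm.
rewrite (eq_bigr (fun v => x v ^+ 2 + 2 * t * (y v * x v) + t ^+ 2 * y v ^+ 2))
  => [|v _]; last by ring.
by rewrite !big_split -!mulr_sumr.
Qed.

Lemma sqnorm_ge0 x : 0 <= sqnorm x.
Proof. by apply: sumr_ge0 => v _; apply: sqr_ge0. Qed.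

Lemma sqnorm_eq0 x : sqnorm x = 0 -> forall v, x v = 0.
Proof.
move=> /eqP; rewrite psumr_eq0 => [/allP x0 v|v _]; last exact: sqr_ge0.
by have := x0 v (mem_index_enum v); rewrite sqrf_eq0 => /eqP.
Qed.

Lemma qformZ (c : R) x : qform (fun v => c * x v) = c ^+ 2 * qform x.
Proof.
by rewrite /qform mulr_sumr; apply: eq_bigr => v _; rewrite /nbr_sum -mulr_sumr; ring.
Qed.

Lemma sqnormZ (c : R) x : sqnorm (fun v => c * x v) = c ^+ 2 * sqnorm x.
Proof. by rewrite /sqnorm mulr_sumr; apply: eq_bigr => v _; ring. Qed.

(* First variation of the Rayleigh quotient in the direction of the residual. *)
Lemma rayleigh_maximizer_eigen (mu : R) x :
  (forall y, qform y <= mu * sqnorm y) -> mu * sqnorm x <= qform x ->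
  forall v, nbr_sum x v = mu * x v.
Proof.
move=> mu_max x_max.
pose h v := nbr_sum x v - mu * x v.
suff h0 : sqnorm h <= 0.
  have := sqnorm_eq0 (le_anti (introT andP (conj h0 (sqnorm_ge0 h)))).
  by move=> hv v; have /eqP := hv v; rewrite subr_eq0 => /eqP.
have hE : sqnorm h = \sum_v h v * nbr_sum x v - mu * \sum_v h v * x v.
  by rewrite mulr_sumr -sumrB; apply: eq_bigr => v _; rewrite {2}/h /h; ring.
pose d := mu * sqnorm h - qform h.
have d_ge0 : 0 <= d by rewrite subr_ge0.
(* Compare [x + t h] with [x]; the coefficient of [2 t] is the inner product of [h] with the
   residual, which is [h] itself. *)
have var t : 2 * t * sqnorm h <= t ^+ 2 * d.
  have := mu_max (fun v => x v + t * h v).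
  rewrite qform_add sqnorm_add /d.
  move: (\sum_v h v * nbr_sum x v) (\sum_v h v * x v) (sqnorm h) hE => s1 s2 s ->.
  lra.
(* This [t] turns the inequality into [s^2 (d + 2) <= 0]; the 1 keeps the denominator positive when
   [d = 0]. *)
have := var (sqnorm h / (d + 1)); set s := sqnorm h.
have s_ge0 : 0 <= s := sqnorm_ge0 h.
have d1 : d + 1 != 0 by rewrite gt_eqF // ltr_wpDl.
have -> : 2 * (s / (d + 1)) * s = 2 * s ^+ 2 * (d + 1) / (d + 1) ^+ 2 by field.
have -> : (s / (d + 1)) ^+ 2 * d = s ^+ 2 * d / (d + 1) ^+ 2 by field.
rewrite ler_pM2r ?invr_gt0 ?exprn_gt0 //; last by rewrite ltr_wpDl.
nra.
Qed.

Local Open Scope classical_set_scope.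

(** The quadratic form attains its maximum on the compact unit sphere, and homogeneity extends the
    bound to all vectors. *)
Lemma exists_rayleigh_maximizer : (0 < #|G|)%N ->
  exists x, sqnorm x = 1 /\ forall y, qform y <= qform x * sqnorm y.
Proof.
move=> /card_gt0P[v0 _].
(* Functions on [G] are read as row vectors to have a topology. *)
pose fn (M : 'rV[R]_#|G|) (v : G) := M 0 (enum_rank v).
have fnK x : fn (\row_i x (enum_val i)) = x.
  by apply: funext => v; rewrite /fn mxE enum_rankK.
have coord_cont v : continuous (fun M => fn M v) by move=> M; apply: coord_continuous.
have sum_cont (P : pred G) (g : G -> 'rV[R]_#|G| -> R) :
    (forall v, continuous (g v)) -> continuous (fun M => \sum_(v | P v) g v M).
  move=> g_cont; elim: (index_enum G) => [|v r IHr].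
    by under eq_fun do rewrite big_nil; apply: cst_continuous.
  under eq_fun do rewrite big_cons.
  by case: (P v) => // M; apply: continuousD; [apply: g_cont|apply: IHr].
have q_cont : continuous (fun M => qform (fn M)).
  apply: (sum_cont _ _ _) => v M; apply: continuousM; first exact: coord_cont.
  by apply: (sum_cont _ _ _) => w; apply: coord_cont.
have n_cont : continuous (fun M => sqnorm (fn M)).
  by apply: (sum_cont _ _ _) => v M; apply: continuousM; apply: coord_cont.
pose S := [set M | sqnorm (fn M) = 1].
have S0 : S !=set0.
  exists (\row_i (enum_val i == v0)%:R); rewrite /S /=.
  rewrite (fnK (fun v => (v == v0)%:R)) /sqnorm.
  rewrite (bigD1 v0) //= eqxx expr1n big1 ?addr0 // => v /negPf->.
  by rewrite expr0n.
have S_compact : compact S.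
  apply: bounded_closed_compact.
    exists 1; split; first exact: num_real.
    move=> c c1 M SM; apply: le_trans (ltW c1); rewrite /Num.Def.normr /=.
    rewrite mx_normrE; apply: bigmax_le => // -[i j] _ /=.
    rewrite -(expr_le1 (n := 2)) // real_normK ?num_real // -[leRHS]SM.
    rewrite ord1 /sqnorm (bigD1 (enum_val j)) //= /fn enum_valK lerDl.
    by apply: sumr_ge0 => v _; apply: sqr_ge0.
  by apply: (@preimage_closed _ _ (fun M => sqnorm (fn M)) [set 1]) => //; apply: closed_eq.
have [M SM M_max] := EVT_max_rV S0 S_compact (continuous_subspaceT q_cont).
exists (fn M); split=> [|y]; first by rewrite in_setE in SM.
have [y0|y_neq0] := eqVneq (sqnorm y) 0.
  rewrite y0 mulr0 /qform big1 // => v _; by rewrite (sqnorm_eq0 y0) mul0r.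
have y_gt0 : 0 < sqnorm y by rewrite lt_neqAle eq_sym y_neq0 sqnorm_ge0.
pose c := Num.sqrt (sqnorm y).
have c2 : c ^+ 2 = sqnorm y by rewrite sqr_sqrtr ?sqnorm_ge0.
have c_neq0 : c != 0 by rewrite -sqrf_eq0 c2.
have := M_max (\row_i (c^-1 * y (enum_val i))).
rewrite in_setE /S /= (fnK (fun v => c^-1 * y v)) sqnormZ qformZ exprVn c2.
by rewrite mulVf // => /(_ erefl); rewrite ler_pdivrMl // mulrC.
Qed.

Lemma eigenvalue_adjmxP (a : R) : eigenvalue (adjmx R G) a <->
  exists y, sqnorm y != 0 /\ forall v, nbr_sum y v = a * y v.
Proof.
have mulE (M : 'rV[R]_#|G|) i : (M *m adjmx R G) 0 i =
    nbr_sum (fun v => M 0 (enum_rank v)) (enum_val i).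
  rewrite mxE /nbr_sum [RHS]big_mkcond /= [RHS](reindex_onto enum_val enum_rank) /=.
    apply: eq_big => [j|j _]; first by rewrite enum_valK eqxx.
    by rewrite enum_valK mxE adj_sym; case: adj; rewrite ?mulr1 ?mulr0.
  by move=> v _; rewrite enum_rankK.
split=> [/eigenvalueP[M MA M0]|[y [y0 yA]]].
  exists (fun v => M 0 (enum_rank v)); split=> [|v].
    apply: contra M0 => /eqP/sqnorm_eq0 M0; apply/eqP/rowP => i.
    by have := M0 (enum_val i); rewrite enum_valK mxE.
  by have /rowP/(_ (enum_rank v)) := MA; rewrite mulE enum_rankK mxE.
apply/eigenvalueP; exists (\row_i y (enum_val i)).
  apply/rowP => i; rewrite mulE !mxE -yA; apply: eq_bigr => w _.
  by rewrite mxE enum_rankK.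
apply: contra y0 => /eqP/rowP y0; apply/eqP/big1 => v _.
by have := y0 (enum_rank v); rewrite !mxE enum_rankK => ->; rewrite expr0n.
Qed.

(** The maximal Rayleigh quotient is an eigenvalue, and every eigenvalue is the quotient of its
    eigenvector. *)
Lemma spectral_radius_rayleigh : (0 < #|G|)%N ->
  exists x, [/\ sqnorm x = 1, qform x = spectral_radius R G &
    forall y, qform y <= spectral_radius R G * sqnorm y].
Proof.
move=> /exists_rayleigh_maximizer[x [x1 x_max]].
have xE := rayleigh_maximizer_eigen x_max.
suff rhoE : spectral_radius R G = qform x by exists x; rewrite rhoE.
have mu_in : eigenvalue (adjmx R G) (qform x).
  by apply/eigenvalue_adjmxP; exists x; split; [rewrite x1 oner_neq0|apply: xE; rewrite x1 mulr1].
have mu_ub : ubound [set a | eigenvalue (adjmx R G) a] (qform x).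
  move=> a /eigenvalue_adjmxP[y [y0 yE]].
  have y_gt0 : 0 < sqnorm y by rewrite lt_neqAle eq_sym y0 sqnorm_ge0.
  rewrite -(ler_pM2r y_gt0); apply: le_trans (x_max y).
  by rewrite /sqnorm mulr_sumr; apply: ler_sum => v _; rewrite yE; lra.
apply/le_anti/andP; split; first by apply: ge_sup => //; exists (qform x).
by apply: ub_le_sup => //; exists (qform x).
Qed.

Lemma qform_le y : (0 < #|G|)%N -> qform y <= spectral_radius R G * sqnorm y.
Proof. by move=> /spectral_radius_rayleigh[x [_ _]]. Qed.

Lemma spectral_radius_eigen x : (0 < #|G|)%N ->
  spectral_radius R G * sqnorm x <= qform x ->
  forall v, nbr_sum x v = spectral_radius R G * x v.
Proof.
by move=> G0; apply: rayleigh_maximizer_eigen => y; apply: qform_le.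
Qed.

(** Taking absolute values keeps the norm and does not lower the form, so a maximizer yields a
    nonnegative eigenvector; divide by its largest entry. Entries may vanish, as [G] need not be
    connected. *)
Lemma perron_vector : (0 < #|G|)%N -> exists (x : G -> R) (z : G),
  [/\ forall v, 0 <= x v <= 1, x z = 1 &
      forall v, nbr_sum x v = spectral_radius R G * x v].
Proof.
move=> G0; have [y [y1 yq _]] := spectral_radius_rayleigh G0.
have yE : forall v, nbr_sum (fun v => `|y v|) v = spectral_radius R G * `|y v|.
  apply: spectral_radius_eigen => //.
  have -> : sqnorm (fun v => `|y v|) = 1.
    by rewrite -y1; apply: eq_bigr => v _; rewrite real_normK ?num_real.
  rewrite mulr1 -yq; apply: ler_sum => v _.
  apply: le_trans (ler_norm _) _; rewrite normrM ler_wpM2l //.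
  exact: ler_norm_sum.
have /card_gt0P[v0 _] := G0.
pose z := [arg max_(v > v0) `|y v|]%O.
have z_max v : `|y v| <= `|y z| by rewrite /z; case: arg_maxP => // i _; apply.
have z_gt0 : 0 < `|y z|.
  rewrite lt_neqAle normr_ge0 andbT eq_sym; apply/negP => /eqP yz0.
  have : sqnorm y = 0.
    apply: big1 => v _; have := z_max v.
    by rewrite yz0 normr_le0 => /eqP->; rewrite expr0n.
  by rewrite y1 => /eqP; rewrite oner_eq0.
exists (fun v => `|y v| / `|y z|), z; split=> [v||v].
- by rewrite divr_ge0 // ler_pdivrMr // mul1r z_max.
- by rewrite divff // gt_eqF.
- by rewrite /nbr_sum -mulr_suml -/(nbr_sum _ v) yE mulrA.
Qed.

Lemma spectral_radius_le_card : (0 < #|G|)%N -> spectral_radius R G <= #|G|%:R.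
Proof.
move=> /perron_vector[x [z [x01 xz xE]]].
have := xE z; rewrite xz mulr1 => <-; rewrite /nbr_sum big_mkcond.
rewrite -sum1_card natr_sum; apply: ler_sum => v _.
by have /andP[] := x01 v; case: adj.
Qed.

End Rayleigh.

Lemma SPEX_max (R : realType) (n : nat) (F G H : sgraph) :
  (0 < n)%N -> SPEX R n F G -> #|H| = n -> F_free F H ->
  (spectral_radius R H <= spectral_radius R G)%R.
Proof.
move=> n_gt0 [_ _ ->] Hn HF; apply: ub_le_sup; last by exists H.
exists (n%:R)%R => _ [K [Kn _ ->]]; rewrite -Kn.
by apply: spectral_radius_le_card; rewrite Kn.
Qed.

Lemma spectral_radius_complete_bipartite (R : realType) (p m : nat) :
  (0 < p)%N -> (0 < m)%N ->
  (Num.sqrt (p * m)%:R <= spectral_radius R (complete_bipartite p m))%R.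
Proof.
move=> p0 m0; set K := complete_bipartite p m.
have [sp sp_gt0 sp2] : exists2 s : R, (0 < s)%R & (s ^+ 2 = p%:R)%R.
  by exists (Num.sqrt p%:R)%R; rewrite ?sqr_sqrtr ?sqrtr_gt0 ?ler0n ?ltr0n.
have [sm sm_gt0 sm2] : exists2 s : R, (0 < s)%R & (s ^+ 2 = m%:R)%R.
  by exists (Num.sqrt m%:R)%R; rewrite ?sqr_sqrtr ?sqrtr_gt0 ?ler0n ?ltr0n.
(* The eigenvector of the complete bipartite graph for [sp * sm]. *)
pose x (v : K) : R := if v is inl _ then sm else sp.
have nbrE v : (nbr_sum x v = if v is inl _ then sm ^+ 2 * sp else sp ^+ 2 * sm)%R.
  rewrite /nbr_sum big_sumType; case: v => i /=.
    by rewrite big_pred0 // add0r sumr_const card_ord ?sm2 ?sp2 mulr_natl.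
  by rewrite [X in (_ + X)%R]big_pred0 // addr0 sumr_const card_ord ?sm2 ?sp2 mulr_natl.
have K0 : (0 < #|K|)%N by rewrite card_sum !card_ord addn_gt0 p0.
have qE : (qform x = 2 * sp ^+ 2 * sm ^+ 2 * (sp * sm))%R.
  rewrite /qform (eq_bigr _ (fun v _ => congr1 (fun t => x v * t)%R (nbrE v))).
  rewrite big_sumType /= !sumr_const !card_ord -(mulr_natl _ p) -(mulr_natl _ m) -sp2 -sm2; ring.
have nE : (sqnorm x = 2 * sp ^+ 2 * sm ^+ 2)%R.
  rewrite /sqnorm big_sumType /= !sumr_const !card_ord -(mulr_natl _ p) -(mulr_natl _ m) -sp2 -sm2; ring.
have := qform_le x K0; rewrite qE nE mulrC ler_pM2r ?mulr_gt0 ?exprn_gt0 //.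
by rewrite natrM -sp2 -sm2 -exprMn sqrtr_sqr ger0_norm // mulr_ge0 // ltW.
Qed.

(** * The structure of extremal graphs *)

Lemma spanning_complete_bipartite (G : sgraph) (L : {set G}) (m : nat) :
  {in L, forall u w, w \notin L -> adj u w} -> #|~: L| = m ->
  exists S : subgraph G,
    spanning S /\ isomorphic S (complete_bipartite #|L| m).
Proof.
move=> LW <-.
(* Keep only the edges between [L] and its complement. *)
pose e (x y : G) := (x \in L) (+) (y \in L).
have e_sym : symmetric e by move=> x y; rewrite /e addbC.
have e_sub x y : e x y -> [/\ x \in [set: G]%SET, y \in [set: G]%SET & adj x y].
  rewrite !inE /e; case xL: (x \in L); case yL: (y \in L) => // _; split=> //.
    by apply: LW; rewrite ?yL.
  by rewrite adj_sym; apply: LW; rewrite ?xL.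
exists (Subgraph e_sym e_sub); split=> //.
pose h0 (i : 'I_#|L| + 'I_#|~: L|) : G :=
  match i with inl i => enum_val i | inr j => enum_val j end.
pose h i : {x : G | x \in [set: G]%SET} := exist _ (h0 i) (in_setT _).
have h0L i : (h0 i \in L) = if i is inl _ then true else false.
  case: i => i /=; first exact: enum_valP.
  by apply: negbTE; have := enum_valP i; rewrite inE.
have h_inj : injective h.
  move=> i j /(congr1 val) /= hij; have := congr1 (fun x => x \in L) hij.
  rewrite !h0L; case: i j hij => [i|i] [j|j] //= /enum_val_inj -> //.
have [|g hK gK] := inj_card_bij h_inj.
  by rewrite card_sum !card_ord cardsC card_sig max_card.
exists g; split; first by exists h.
move=> x y; change (@adj (complete_bipartite #|L| #|~: L|) (g x) (g y) = e (val x) (val y)).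
rewrite -{2}(gK x) -{2}(gK y) /e /= !h0L.
by case: (g x) (g y) => [?|?] [?|?].
Qed.

(** * Counting neighbours, and the effect of rewiring *)

Section Counting.
Local Open Scope ring_scope.
Variables (R : realType) (G : sgraph).

Lemma sum_nbrs_le (x : G -> R) (S : {set G}) (c : R) (v : G) :
  {in S, forall w, x w <= c} -> \sum_(w in S | adj v w) x w <= c * (deg_in S v)%:R.
Proof.
move=> xc; apply: (@le_trans _ _ (\sum_(w in S | adj v w) c)).
  by apply: ler_sum => w /andP[/xc].
by rewrite sumr_const mulr_natr (eq_card (B := mem [set w in S | adj v w])) // => w; rewrite !inE.
Qed.

Lemma deg_in_le (S T : {set G}) (v : G) : S \subset T -> (deg_in S v <= deg_in T v)%N.
Proof.
move=> /subsetP ST; apply/subset_leq_card/subsetP => w.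
by rewrite !inE => /andP[/ST-> ->].
Qed.

Lemma deg_in_le_card (S : {set G}) (v : G) : (deg_in S v <= #|S|)%N.
Proof. by apply/subset_leq_card/subsetP => w; rewrite inE => /andP[]. Qed.

Lemma deg_inU (S T : {set G}) (v : G) : (deg_in (S :|: T) v <= deg_in S v + deg_in T v)%N.
Proof.
apply: leq_trans (leq_card_setU _ _); apply/subset_leq_card/subsetP => w.
by rewrite !inE andb_orl.
Qed.

(** Union bound: each vertex outside the common neighbourhood is a non-neighbour of some [s] in
    [S]. *)
Lemma card_common_nbrs_ge (S : {set G}) :
  (#|G| <= #|common_nbrs S| + \sum_(s in S) (#|G| - deg_in setT s))%N.
Proof.
rewrite -[X in (X <= _)%N](cardsC (common_nbrs S)) leq_add2l.
rewrite -sum1_card; apply: (@leq_trans (\sum_w \sum_(s in S) ~~ adj s w)).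
  rewrite big_mkcond; apply: leq_sum => w _; case: ifP => //.
  rewrite inE => /negP wS.
  have [s sS sw] : exists2 s, s \in S & ~~ adj s w.
    apply: contrapT => none; apply: wS; apply/common_nbrsP => s sS.
    by apply: contrapT => /negP sw; apply: none; exists s.
  by rewrite (bigD1 s) //= sw.
rewrite exchange_big /=; apply: leq_sum => s _.
rewrite leq_subRL -?cardsT ?deg_in_le_card // deg_inE.
rewrite [X in (_ + X <= _)%N](eq_bigl (fun w => w \in [set: G]%SET)) => [|w];
  last by rewrite inE.
rewrite -big_split /= -sum1_card; apply: leq_sum => w _.
by case: adj.
Qed.

Lemma exists_subset_card (S : {set G}) (m : nat) : (m <= #|S|)%N ->
  exists2 T : {set G}, T \subset S & #|T| = m.
Proof.
move=> mS; exists [set w in take m (enum S)].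
  by apply/subsetP => w; rewrite inE => /mem_take; rewrite mem_enum.
rewrite cardsE; have /card_uniqP-> : uniq (take m (enum S)).
  by rewrite take_uniq ?enum_uniq.
by rewrite size_take -cardE; case: ltngtP mS.
Qed.

(** Only pairs containing [v] change, and each is counted in both orders. *)
Lemma qform_rewire (x : G -> R) (L : {set G}) (v : G) (vL : v \notin L) :
  @qform R (rewire vL) x =
  qform x + 2 * x v * (\sum_(w in L) x w - nbr_sum x v).
Proof.
have nbr_v : @nbr_sum R (rewire vL) x v = \sum_(w in L) x w.
  by apply: eq_bigl => w; rewrite rewireE eqxx.
have nbr_u u : u != v -> @nbr_sum R (rewire vL) x u =
    nbr_sum x u + ((u \in L)%:R - (adj v u)%:R) * x v.
  move=> uv; rewrite /nbr_sum [LHS]big_mkcond [X in X + _]big_mkcond /=.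
  rewrite (bigD1 v) //= [X in _ = X + _](bigD1 v) //=.
  rewrite (negPf uv) eqxx (adj_sym v u).
  rewrite (eq_bigr (fun w => if adj u w then x w else 0)) => [|w wv]; last first.
    by rewrite (negPf wv).
  rewrite [RHS]addrAC; congr (_ + _).
  by case: (u \in L); case: (adj u v);
    rewrite /= ?mulr1n ?mulr0n; ring.
rewrite /qform (bigD1 v) //= [in RHS](bigD1 v) //= nbr_v.
under eq_bigr => u uv do rewrite (nbr_u u uv) mulrDr mulrCA mulrA.
rewrite big_split /= -mulr_suml.
have -> : \sum_(u | u != v) ((u \in L)%:R - (adj v u)%:R) * x u =
    \sum_(w in L) x w - nbr_sum x v.
  rewrite /nbr_sum [\sum_(w in L) _]big_mkcond [\sum_(w | adj v w) _]big_mkcond.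
  rewrite -sumrB [in RHS](bigD1 v) //= (negPf vL) adj_irr subrr add0r.
  by apply: eq_bigr => u _; case: (u \in L); case: adj;
    rewrite /= ?mulr1n ?mulr0n; ring.
ring.
Qed.

End Counting.

(** * Degrees and Perron entries in an extremal graph *)

Section Extremal.
Local Open Scope ring_scope.
Variables (R : realType) (F G : sgraph) (A B : {set F}).
Hypotheses (F_tree : is_tree F) (AB_parts : partite_sets A B).
Hypotheses (G_free : F_free F G) (A_gt1 : (1 < #|A|)%N).

Let rho := spectral_radius R G.
Let k : R := #|F|%:R.
Let n : R := #|G|%:R.
Let q : R := (#|A| - 1)%:R.
Let A_gt0 : (0 < #|A|)%N := ltnW A_gt1.

Variables (x : G -> R) (z : G) (eta : R).
Hypotheses (x01 : forall v, 0 <= x v <= 1) (xz : x z = 1).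
Hypothesis xE : forall v, nbr_sum x v = rho * x v.
Hypotheses (eta_gt0 : 0 < eta) (rho_large : 2 * k <= eta ^+ 2 * rho).
Hypotheses (rho_sq : q * (n - q) <= rho ^+ 2) (n_large : q ^+ 2 <= eta * n).

Fact k_ge1 : 1 <= k.
Proof. by rewrite ler1n; apply: leq_trans A_gt0 (max_card _). Qed.

Fact q_ge1 : 1 <= q.
Proof. by rewrite ler1n subn_gt0. Qed.

Fact n_ge0 : 0 <= n. Proof. exact: ler0n. Qed.

Fact rho_gt0 : 0 < rho.
Proof.
have : 0 < eta ^+ 2 * rho by apply: lt_le_trans rho_large; have := k_ge1; lra.
by rewrite pmulr_rgt0 // exprn_gt0.
Qed.

#[local] Hint Resolve k_ge1 q_ge1 n_ge0 rho_gt0 : core.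

Let deg (v : G) : R := (deg_in [set: G]%SET v)%:R.

Fact sum_deg : \sum_v deg v <= 2 * k * n.
Proof.
have := sum_deg_in F_tree G_free [set: G]%SET; rewrite -(ler_nat R) natr_sum.
rewrite !natrM cardsT (eq_bigl xpredT) => [//|v]; by rewrite inE.
Qed.

Let heavy : {set G} := [set v | eta <= x v].

(** A heavy vertex has degree at least [eta * rho], while all degrees sum to at most [2 k n]. *)
Lemma card_heavy : #|heavy|%:R <= eta * n.
Proof.
have le1 : eta * rho * #|heavy|%:R <= 2 * k * n.
  apply: le_trans sum_deg.
  apply: (@le_trans _ _ (\sum_(v in heavy) deg v)).
    rewrite mulr_natr -sumr_const; apply: ler_sum => v; rewrite inE => xv.
    apply: (@le_trans _ _ (nbr_sum x v)).
      by rewrite xE mulrC ler_pM2l.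
    have -> : nbr_sum x v = \sum_(w in [set: G]%SET | adj v w) x w.
      by apply: eq_bigl => w; rewrite inE.
    by rewrite -[deg v]mul1r; apply: sum_nbrs_le => w _; have /andP[] := x01 w.
  rewrite [leRHS](bigID (mem heavy)) /= lerDl.
  by apply: sumr_ge0 => v _; apply: ler0n.
have pos : 0 < eta * rho by rewrite mulr_gt0.
rewrite -(ler_pM2l pos); apply: le_trans le1 _.
have -> : eta * rho * (eta * n) = eta ^+ 2 * rho * n by ring.
by rewrite ler_wpM2r.
Qed.

(** Walks [v], [u], [w] with [w] light contribute at most [eta] times the degree sum, those with [u]
    and [w] heavy at most the degree sum inside [heavy]. Each is at most [2 k eta n]. *)
Lemma two_step_walks v : rho ^+ 2 * x v <= 4 * k * (eta * n) +
  \sum_(u in ~: heavy | adj v u) \sum_(w in heavy | adj u w) x w.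
Proof.
have eqle (a b : R) : a = b -> a <= b by move=> ->.
have x_ge0 w : 0 <= x w by have /andP[] := x01 w.
pose inner u := \sum_(w in heavy | adj u w) x w.
have inner_ge0 u : 0 <= inner u by apply: sumr_ge0.
have split_u u : nbr_sum x u <= inner u + eta * deg u.
  rewrite /nbr_sum (bigID (mem heavy)) /=; apply: lerD.
    by apply/eqle/eq_bigl => w; rewrite andbC.
  apply: (@le_trans _ _ (eta * (deg_in (~: heavy) u)%:R)); last first.
    by rewrite ler_pM2l // ler_nat deg_in_le // finset.subsetT.
  rewrite (eq_bigl (fun w => (w \in ~: heavy) && adj u w)) => [|w]; last first.
    by rewrite in_setC andbC.
  by apply: sum_nbrs_le => w; rewrite !inE -ltNge => /ltW.
have -> : rho ^+ 2 * x v = \sum_(u | adj v u) nbr_sum x u.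
  rewrite expr2 -mulrA -xE mulr_sumr; apply: eq_bigr => u _; by rewrite xE.
have le1 : \sum_(u | adj v u) nbr_sum x u <= \sum_(u | adj v u) inner u + 2 * k * (eta * n).
  apply: le_trans (ler_sum _ (fun u _ => split_u u)) _.
  rewrite big_split /= lerD2l -mulr_sumr mulrCA ler_pM2l //.
  apply: le_trans sum_deg; rewrite [leRHS](bigID (adj v)) /= lerDl.
  by apply: sumr_ge0 => u _; apply: ler0n.
have le2 : \sum_(u | adj v u) inner u <= 2 * k * (eta * n) +
    \sum_(u in ~: heavy | adj v u) inner u.
  rewrite (bigID (mem heavy)) /=; apply: lerD; last first.
    by apply/eqle/eq_bigl => w; rewrite !inE andbC.
  apply: (@le_trans _ _ (\sum_(u in heavy) (deg_in heavy u)%:R)).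
    rewrite [leRHS](bigID (adj v)) /= -[leLHS]addr0; apply: lerD; last first.
      by apply: sumr_ge0 => u _; apply: ler0n.
    rewrite (eq_bigl (fun u => (u \in heavy) && adj v u)) => [|u]; last by rewrite andbC.
    apply: ler_sum => u _; rewrite -[leRHS]mul1r; apply: sum_nbrs_le => w _.
    by have /andP[] := x01 w.
  have := sum_deg_in F_tree G_free heavy; rewrite -(ler_nat R) natr_sum => le.
  apply: le_trans le _; rewrite !natrM ler_pM2l ?card_heavy //.
  by rewrite mulr_gt0 //; apply: lt_le_trans k_ge1.
apply: le_trans le1 _; move: le2; rewrite -/inner; lra.
Qed.

Lemma sum_deg_in_light v : \sum_(u in ~: heavy | adj v u) (deg_in heavy u)%:R <=
  q * deg v + k * (eta * n).
Proof.
pose Y := [set u in ~: heavy | adj v u].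
have XY : [disjoint heavy & Y].
  by apply/pred0P => u /=; rewrite !inE; case: (eta <= x u).
have := sum_deg_in_bipartite F_tree AB_parts G_free A_gt0 XY.
rewrite -(ler_nat R) natr_sum natrD !natrM => le.
rewrite (eq_bigl (mem Y)) => [|u]; last by rewrite !inE.
apply: le_trans le _; apply: lerD; last by rewrite ler_wpM2l ?ler0n ?card_heavy.
by rewrite ler_wpM2l ?ler0n // ler_nat deg_in_le // finset.subsetT.
Qed.

(** The 6 adds up the errors [k * eta * n] in [deg_ge]: four from [two_step_walks], one each from
    [sum_deg_in_light] and [rho_sq_ge]. *)
Let eps : R := 6 * k * eta.

Fact rho_sq_ge t : 0 <= t <= 1 -> q * n * t <= rho ^+ 2 * t + k * (eta * n).
Proof.
move=> /andP[t0 t1].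
have le1 : q * (n - q) * t <= rho ^+ 2 * t by rewrite ler_wpM2r.
have le2 : q ^+ 2 * t <= q ^+ 2 by rewrite ler_piMr // sqr_ge0.
have le3 : eta * n <= k * (eta * n) by rewrite ler_peMl // mulr_ge0 // ltW.
have := n_large; lra.
Qed.

Lemma deg_ge v : (x v - eps) * n <= deg v.
Proof.
have inner : \sum_(u in ~: heavy | adj v u) \sum_(w in heavy | adj u w) x w <=
    q * deg v + k * (eta * n).
  apply: le_trans (sum_deg_in_light v); apply: ler_sum => u _.
  by rewrite -[leRHS]mul1r; apply: sum_nbrs_le => w _; have /andP[] := x01 w.
have le1 := two_step_walks v; have le2 := rho_sq_ge (x01 v).
have en : eps * n = 6 * (k * (eta * n)) by rewrite /eps; ring.
have kn_ge0 : 0 <= k * (eta * n) by rewrite !mulr_ge0 ?ler0n // ltW.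
have le3 : q * (x v * n - deg v) <= eps * n by rewrite en; lra.
rewrite mulrBl lerBlDr -lerBlDl.
have [neg|pos] := leP (x v * n - deg v) 0.
  by apply: le_trans neg _; rewrite en; lra.
by apply: le_trans le3; rewrite ler_peMl // ltW.
Qed.

(** * The vertices of nearly maximal Perron entry *)

Hypotheses (eps_small : 20 * k ^+ 2 * eps <= 1) (n_large' : k + 1 <= eps * n).

Fact eps_gt0 : 0 < eps.
Proof. by rewrite /eps !mulr_gt0 //; apply: lt_le_trans k_ge1. Qed.

#[local] Hint Resolve eps_gt0 : core.

Fact keps_small : 20 * k * eps <= 1.
Proof.
apply: le_trans eps_small; rewrite ler_pM2r // expr2 mulrA ler_peMr //.
by rewrite mulr_ge0 ?ler0n.
Qed.

Fact q_lt_k : q + 1 <= k.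
Proof. by rewrite natr1 ler_nat subn1 prednK // max_card. Qed.

Let top : {set G} := [set v | 1 - 2 * eps <= x v].

(** By [deg_ge], a vertex of [top] has at most [3 eps n] non-neighbours. *)
Lemma card_common_nbrs_top (S : {set G}) : S \subset top ->
  n - 3 * (#|S|%:R * (eps * n)) <= #|common_nbrs S|%:R.
Proof.
move=> /subsetP Stop.
have := card_common_nbrs_ge S; rewrite -(ler_nat R) natrD natr_sum => le1.
have le2 : \sum_(s in S) ((#|G| - deg_in [set: G]%SET s)%:R : R) <=
    #|S|%:R * (3 * (eps * n)).
  rewrite mulr_natl -sumr_const; apply: ler_sum => s /Stop; rewrite inE => xs.
  rewrite natrB -?cardsT ?deg_in_le_card // cardsT -/n.
  have := deg_ge s; rewrite -/(deg s).
  have : (1 - 2 * eps) * n <= x s * n by rewrite ler_wpM2r.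
  lra.
move: le1 le2; rewrite -/n; lra.
Qed.

Fact half_n t : t <= k -> 3 * (t * (eps * n)) <= n / 2.
Proof.
move=> tk.
have le1 : t * (eps * n) <= k * (eps * n).
  by rewrite ler_wpM2r // mulr_ge0 // ltW.
have le2 : 20 * k * eps * n <= 1 * n by rewrite ler_wpM2r ?keps_small.
have := n_ge0; lra.
Qed.

Fact k_lt_half : k + 1 <= n / 2.
Proof.
apply: le_trans n_large' _; rewrite mulrC ler_wpM2l //.
have : 20 * eps <= 20 * k * eps.
  by rewrite -!mulrA ler_pM2l // ler_peMl // ltW.
have := keps_small; lra.
Qed.

Lemma card_top_le : (#|top| < #|A|)%N.
Proof.
rewrite ltnNge; apply/negP => /exists_subset_card[S Stop SA].
have := card_common_nbrs_lt F_tree AB_parts G_free A_gt0 SA.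
rewrite -(ltr_nat R); have := card_common_nbrs_top Stop; rewrite SA.
have := @half_n #|A|%:R; rewrite ler_nat max_card => /(_ isT).
have := k_lt_half; rewrite -/k; lra.
Qed.

(** With at most [q - 1] vertices in [top], the walks from [z] lose at least [2 eps n] against
    [q n], but the error terms amount to at most [eps n]. *)
Lemma card_top : #|top| = (#|A| - 1)%N.
Proof.
apply/eqP; rewrite eqn_leq -ltnS subn1 prednK // card_top_le /=.
rewrite leqNgt; apply/negP => top_lt.
have {top_lt} top_q : #|top|%:R + 1 <= q by rewrite natr1 ler_nat subn1.
have eps20 : 20 * eps <= 1.
  apply: le_trans keps_small; rewrite ler_pM2r // ler_peMr //.
have two_eps : 0 <= 1 - 2 * eps by lra.
(* Entries are at most [1 - 2 eps], plus [2 eps] on [top]. *)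
have inner u : \sum_(w in heavy | adj u w) x w <=
    (1 - 2 * eps) * (deg_in heavy u)%:R + 2 * eps * #|top|%:R.
  apply: (@le_trans _ _ ((1 - 2 * eps) * (deg_in heavy u)%:R
      + 2 * eps * (deg_in top u)%:R)); last first.
    by rewrite lerD2l ler_pM2l ?(mulr_gt0 _ eps_gt0) ?ltr0n // ler_nat deg_in_le_card.
  have split_w w : x w <= (1 - 2 * eps) + 2 * eps * (w \in top)%:R.
    rewrite inE; have [_|/ltW] := leP (1 - 2 * eps) (x w); rewrite /=;
      last by rewrite mulr0n; lra.
    by have /andP[_] := x01 w; rewrite mulr1n; lra.
  apply: (le_trans (ler_sum _ (fun w _ => split_w w))).
  rewrite big_split /=; apply: lerD.
    exact: (@sum_nbrs_le R G (fun=> 1 - 2 * eps)).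
  rewrite -mulr_sumr ler_pM2l ?(mulr_gt0 _ eps_gt0) ?ltr0n //.
  rewrite deg_inE natr_sum [leLHS]big_mkcond [leRHS]big_mkcond /=.
  by apply: ler_sum => w _; case: (w \in heavy); case: (w \in top); case: adj.
have sum_inner : \sum_(u in ~: heavy | adj z u) \sum_(w in heavy | adj u w) x w <=
    (1 - 2 * eps) * (q * n + k * (eta * n)) + 2 * eps * #|top|%:R * n.
  apply: (le_trans (ler_sum _ (fun u _ => inner u))).
  rewrite big_split /= -mulr_sumr; apply: lerD.
    rewrite ler_wpM2l //; apply: le_trans (sum_deg_in_light z) _.
    by rewrite lerD2r ler_wpM2l ?ler0n // ler_nat -cardsT deg_in_le_card.
  rewrite sumr_const -[leLHS]mulr_natr ler_wpM2l //; last first.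
    by rewrite ler_nat max_card.
  by rewrite !mulr_ge0 ?ler0n // ltW.
have := two_step_walks z; have := @rho_sq_ge 1; rewrite ler01 lexx xz !mulr1.
move=> /(_ isT) le1 le2.
have en : eps * n = 6 * (k * (eta * n)) by rewrite /eps; ring.
have en_gt0 : 0 < eps * n by apply: lt_le_trans n_large'; have := k_ge1; lra.
have le3 : #|top|%:R * (eps * n) <= (q - 1) * (eps * n) by rewrite ler_pM2r //; lra.
have le4 : 0 <= eps * (k * (eta * n)) by rewrite !mulr_ge0 ?ler0n // ltW.
lra.
Qed.

Let W := common_nbrs top.

(** Neighbours of [v] in [W] are common neighbours of the [|A|] vertices in [v |: top]. *)
Lemma deg_in_common_nbrs_top v : v \notin top -> (deg_in W v < #|F|)%N.
Proof.
move=> v_top; have SA : #|v |: top| = #|A|.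
  by rewrite cardsU1 v_top card_top subnKC.
apply: leq_ltn_trans (card_common_nbrs_lt F_tree AB_parts G_free A_gt0 SA).
apply/subset_leq_card/subsetP => w; rewrite inE => /andP[/common_nbrsP wW vw].
by apply/common_nbrsP => s; rewrite !inE => /predU1P[->|] // s_top; apply: wW; rewrite inE.
Qed.

(** The degree of [v] is at most [k] plus the [3 q eps n] vertices that [W] may miss; [deg_ge] turns
    this into a bound on [x v]. *)
Lemma perron_entry_le v : v \notin top -> x v <= 3 * k * eps.
Proof.
move=> v_top.
have W_ge := card_common_nbrs_top (subxx top); rewrite card_top -/q -/W in W_ge.
have W_card : #|W|%:R + #|~: W|%:R = n by rewrite -natrD cardsC.
have deg_v : deg v <= k + #|~: W|%:R.
  rewrite -natrD ler_nat -(setUCr W); apply: leq_trans (deg_inU _ _ _) _.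
  by apply: leq_add; [apply/ltnW/deg_in_common_nbrs_top|apply: deg_in_le_card].
have n_gt0 : 0 < n.
  have : 0 < eps * n by apply: lt_le_trans n_large'; have := k_ge1; lra.
  by rewrite pmulr_rgt0.
rewrite -(ler_pM2r n_gt0).
have en_ge0 : 0 <= eps * n by rewrite mulr_ge0 // ltW.
have le1 : (q + 1) * (eps * n) <= k * (eps * n) by rewrite ler_wpM2r ?q_lt_k.
have := deg_ge v; have := n_large'; lra.
Qed.

(** Vertices outside [top] lie in [W] or [T]. With fewer than [k] neighbours in [W] but more than
    [3k] outside [top], all vertices of [T] would have more than [2k] in [T], against
    [sum_deg_in]. *)
Lemma exists_rewirable v0 : v0 \notin top -> v0 \notin W ->
  exists v, [/\ v \notin top, v \notin W & (deg_in (~: top) v <= 3 * #|F|)%N].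
Proof.
move=> v0_top v0_W; apply: contrapT => none.
pose T := ~: (top :|: W).
have T_card : (0 < #|T|)%N.
  by apply/card_gt0P; exists v0; rewrite in_setC in_setU negb_or v0_top.
have le1 : (\sum_(v in T) (3 * #|F|).+1 <= \sum_(v in T) (deg_in W v + deg_in T v))%N.
  apply: leq_sum => v; rewrite in_setC in_setU negb_or => /andP[v_top v_W].
  apply: (@leq_trans (deg_in (~: top) v)).
    by rewrite ltnNge; apply/negP => v_deg; apply: none; exists v.
  apply: leq_trans (deg_inU _ _ _); apply: deg_in_le.
  apply/subsetP => w; rewrite !(in_setC, in_setU) negb_or.
  by case: (w \in W) => //= ->.
have le2 : (\sum_(v in T) deg_in W v <= \sum_(v in T) #|F|)%N.
  apply: leq_sum => v; rewrite in_setC in_setU negb_or => /andP[v_top _].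
  exact/ltnW/deg_in_common_nbrs_top.
have := sum_deg_in F_tree G_free T.
by move: le1 le2; rewrite big_split /= !sum_nat_const; nia.
Qed.

Hypothesis rho_max : forall H : sgraph, #|H| = #|G| -> F_free F H ->
  spectral_radius R H <= rho.

Lemma top_complete : {in top, forall u w, w \notin top -> adj u w}.
Proof.
move=> u0 u0_top w0 w0_top; apply: contrapT => u0w0.
have [|v [v_top v_W v_deg]] := exists_rewirable w0_top.
  by apply/negP => /common_nbrsP/(_ u0 u0_top).
have W_large : (#|F| < #|W|)%N.
  rewrite -(ltr_nat R) -/k; have := card_common_nbrs_top (subxx top).
  rewrite card_top -/q -/W; have := @half_n q; have := k_lt_half.
  have := q_lt_k; have := k_ge1 => k1 qk1 kn /(_ _); lra.
have H_free := rewire_F_free (vL := v_top) G_free W_large.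
have rho_le := rho_max (H := rewire v_top) erefl H_free.
have G_gt0 : (0 < #|G|)%N by apply/card_gt0P; exists v.
have x_ge0 w : 0 <= x w by have /andP[] := x01 w.
have gain : nbr_sum x v < \sum_(w in top) x w.
  have [u u_top uv] : exists2 u, u \in top & ~~ adj v u.
    apply: contrapT => none; move/negP: v_W; apply; apply/common_nbrsP => s s_top.
    by apply: contrapT => sv; apply: none; exists s; rewrite // adj_sym; apply/negP.
  (* The bound [9 k^2 eps] is at most 9/20, whereas the missed vertex [u] weighs at least 9/10. *)
  have light : \sum_(w in ~: top | adj v w) x w <= 3 * k * eps * (3 * k).
    apply: (@le_trans _ _ (3 * k * eps * (deg_in (~: top) v)%:R)).
      by apply: sum_nbrs_le => w; rewrite in_setC; apply: perron_entry_le.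
    have -> : 3 * k = (3 * #|F|)%:R by rewrite natrM.
    by rewrite ler_wpM2l ?ler_nat // mulr_ge0 ?ler0n ?(ltW eps_gt0).
  have heavy_part : x u + \sum_(w in top | adj v w) x w <= \sum_(w in top) x w.
    rewrite [leRHS](bigD1 u) //= lerD2l [leRHS](bigID (adj v)) /=.
    rewrite -[leLHS]addr0; apply: lerD; last exact: sumr_ge0.
    rewrite (eq_bigl (fun w => (w \in top) && (w != u) && adj v w)) // => w.
    by case: (eqVneq w u) => [->|]; rewrite ?(negPf uv) ?andbF ?andbT.
  have nbrE : nbr_sum x v = \sum_(w in top | adj v w) x w +
      \sum_(w in ~: top | adj v w) x w.
    rewrite /nbr_sum (bigID (mem top)) /=.
    by congr (_ + _); apply: eq_bigl => w; rewrite ?in_setC andbC.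
  have xu : 1 - 2 * eps <= x u by rewrite inE in u_top.
  have eps20 : 20 * eps <= 1.
    by apply: le_trans keps_small; rewrite ler_pM2r // ler_peMr.
  rewrite nbrE; have := eps_small; have := eps_gt0; lra.
have G_eigen : qform x = rho * sqnorm x.
  by rewrite mulr_sumr; apply: eq_bigr => w _; rewrite xE; ring.
(* Since [x v] may be 0, the form need not grow strictly. Instead [x] becomes an eigenvector of the
   rewired graph, and its equation at [v] contradicts [gain]. *)
have key : spectral_radius R (rewire v_top) * @sqnorm R (rewire v_top) x <=
    @qform R (rewire v_top) x.
  rewrite qform_rewire G_eigen; apply: (@le_trans _ _ (rho * sqnorm x)).
    by rewrite ler_wpM2r // sqnorm_ge0.
  by rewrite lerDl !mulr_ge0 ?ler0n ?subr_ge0 // ltW.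
have := @spectral_radius_eigen R (rewire v_top) x G_gt0 key v.
have -> : @nbr_sum R (rewire v_top) x v = \sum_(w in top) x w.
  by apply: eq_bigl => w; rewrite rewireE eqxx.
move=> H_eigen; move: gain; rewrite H_eigen xE ltNge => /negP; apply.
by rewrite ler_wpM2r.
Qed.

End Extremal.

(** * Choice of constants and conclusion *)

Theorem theorem1p1 (R : realType) (F : sgraph) (l : nat) (A B : {set F})
    (q : nat) (F_tree : is_tree F) (F_card : #|F| = l) (l_ge4 : (4 <= l)%N)
    (AB_parts : partite_sets A B) (leAB : (#|A| <= #|B|)%N)
    (q_def : q = (#|A| - 1)%N) (q_ge1 : (1 <= q)%N) :
  exists n0 : nat, forall n : nat, (n0 <= n)%N ->
    forall G : sgraph, SPEX R n F G ->
      exists S : subgraph G,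
        spanning S /\ isomorphic S (complete_bipartite q (n - q)).
Proof.
have q_lt : (q < #|A|)%N by lia.
have A_gt1 : (1 < #|A|)%N by lia.
pose k : R := #|F|%:R%R.
(* Chosen so that [20 k^2 eps = 1] for [eps = 6 k eta]. *)
pose eta : R := ((120 * k ^+ 3)^-1)%R.
have k_gt0 : (0 < k)%R by rewrite ltr0n F_card; lia.
have eta_gt0 : (0 < eta)%R by rewrite invr_gt0 mulr_gt0 ?exprn_gt0.
have eps_gt0 : (0 < 6 * k * eta)%R by rewrite !mulr_gt0.
have epsE : (20 * k ^+ 2 * (6 * k * eta) = 1)%R.
  by rewrite /eta; field; rewrite gt_eqF.
(* [b1] and [b2] are thresholds for [n], [b3] one for [rho]. As [rho^2 >= n - q], the bound [b]
   contains [b3^2 + q]; the final 1 forces [q < n]. *)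
pose b1 : R := ((k + 1) / (6 * k * eta))%R.
pose b2 : R := (q%:R ^+ 2 / eta)%R.
pose b3 : R := (2 * k / eta ^+ 2)%R.
have b1_ge0 : (0 <= b1)%R by rewrite divr_ge0 ?addr_ge0 // ltW.
have b2_ge0 : (0 <= b2)%R by rewrite divr_ge0 ?sqr_ge0 // ltW.
have b3_ge0 : (0 <= b3)%R by rewrite divr_ge0 ?sqr_ge0 ?mulr_ge0 // ltW.
pose b : R := (b1 + b2 + b3 ^+ 2 + q%:R + 1)%R.
have b_ge0 : (0 <= b)%R by rewrite !addr_ge0 ?ler0n ?sqr_ge0.
exists (Num.bound b) => n n0_le G G_ext.
have n_ge : (b <= n%:R)%R.
  by apply: le_trans (ltW (archi_boundP b_ge0)) _; rewrite ler_nat.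
have q_ge0 : (0 <= q%:R :> R)%R by apply: ler0n.
have b3_sq : (0 <= b3 ^+ 2)%R by apply: sqr_ge0.
have n_ge1 : (b1 <= n%:R)%R by move: n_ge; rewrite /b; lra.
have n_ge2 : (b2 <= n%:R)%R by move: n_ge; rewrite /b; lra.
have n_ge3 : (b3 ^+ 2 + q%:R + 1 <= n%:R)%R by move: n_ge; rewrite /b; lra.
have q_lt_n : (q < n)%N by rewrite -(ltr_nat R); lra.
have n_gt0 : (0 < n)%N := leq_ltn_trans (leq0n q) q_lt_n.
have [G_card G_free _] := G_ext.
set rho := spectral_radius R G.
have rho_max (H : sgraph) : #|H| = #|G| -> F_free F H -> (spectral_radius R H <= rho)%R.
  by rewrite G_card; apply: SPEX_max.
have rho_sqrt : (Num.sqrt (q * (n - q))%:R <= rho)%R.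
  apply: le_trans (spectral_radius_complete_bipartite R q_ge1 _) _.
    by rewrite subn_gt0.
  apply: rho_max; first by rewrite card_sum !card_ord G_card subnKC // ltnW.
  exact: (complete_bipartite_F_free F_tree AB_parts).
have rho_ge0 : (0 <= rho)%R by apply: le_trans rho_sqrt; apply: sqrtr_ge0.
have rho_sq : (q%:R * (n%:R - q%:R) <= rho ^+ 2)%R.
  apply: (@le_trans _ _ (Num.sqrt (q * (n - q))%:R ^+ 2)%R).
    by rewrite sqr_sqrtr ?ler0n // natrM (natrB _ (ltnW q_lt_n)).
  by rewrite lerXn2r // nnegrE sqrtr_ge0.
have rho_large : (2 * k <= eta ^+ 2 * rho)%R.
  rewrite [leRHS]mulrC -ler_pdivrMr ?exprn_gt0 // -/b3.
  rewrite -ler_sqr ?nnegrE //; apply: le_trans rho_sq.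
  apply: (@le_trans _ _ (n%:R - q%:R)%R); first lra.
  by rewrite ler_peMl ?ler1n //; lra.
have n_large : (q%:R ^+ 2 <= eta * n%:R)%R.
  by rewrite [leRHS]mulrC -ler_pdivrMr // -/b2.
have n_large' : (k + 1 <= 6 * k * eta * n%:R)%R.
  by rewrite [leRHS]mulrC -ler_pdivrMr // -/b1.
have G_gt0 : (0 < #|G|)%N by rewrite G_card.
have [x [z [x01 xz xE]]] := perron_vector R G_gt0.
have eps_small : (20 * k ^+ 2 * (6 * k * eta) <= 1)%R by rewrite epsE.
rewrite -G_card in rho_sq n_large n_large' *.
rewrite q_def in rho_sq n_large *.
have topE := card_top F_tree AB_parts G_free A_gt1 x01 xz xE eta_gt0 rho_large
  rho_sq n_large eps_small n_large'.
have complete := top_complete F_tree AB_parts G_free A_gt1 x01 xz xE eta_gt0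
  rho_large rho_sq n_large eps_small n_large' rho_max.
rewrite -topE; apply: spanning_complete_bipartite complete _.
by rewrite cardsCs setCK.
Qed.
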